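(* Let $2\le p<q$ be real numbers. There exists a strongly annular function $f$, analytic in the open unit disc $\mathbb D$, whose sequence of Taylor coefficients $\widehat f=(\widehat f(n))_{n\ge0}$ satisfies $\widehat f\in\ell^q\setminus\widetilde\ell^{\,p}$.
   Context: A function $f(z)=\sum_{n\ge0}\widehat f(n)z^n$ analytic in $\mathbb D$ is called strongly annular if $\limsup_{r\to1}\min_{|z|=r}|f(z)|=\infty$. For $0<p<\infty$, $$\widetilde\ell^{\,p}=\Bigl\{\{a_n\}_{n\ge0}:\ \sum_{k\ge0}\min\left(|a_{2k}|^p,|a_{2k+1}|^p\right)<\infty\Bigr\}.$$ *)

(* Defs.v *)
(* The complex plane is [R[i]] for [R : realType]; it is
   written [R[i]^o] where its topology and normed module structure are used. *)
From HB Require Import structures.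
From mathcomp Require Import all_boot all_order all_algebra.
From mathcomp Require Import all_classical all_reals all_analysis.
From mathcomp Require Import complex.

Set Implicit Arguments.
Unset Strict Implicit.
Unset Printing Implicit Defensive.

Import Order.TTheory GRing.Theory Num.Theory numFieldNormedType.Exports.
Import Normc.

Local Open Scope classical_set_scope.
Local Open Scope ring_scope.

Section annular.
Variable R : realType.
Implicit Types (f : R[i] -> R[i]) (a : nat -> R[i]) (p : R).

(* [normc : R[i] -> R] is the real-valued modulus. *)
Definition unit_disc : set R[i] := [set z | normc z < 1].

(* The scalar field of [R[i]^o] is [R[i]], so derivability in the direction 1
   is complex differentiability. Values of [f] outside the disc play no role. *)
Definition analytic_in_disc f :=
  forall z, unit_disc z -> derivable (f : R[i]^o -> R[i]^o) (z : R[i]^o) 1.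

Definition taylor_coefficients f a :=
  forall z, unit_disc z ->
    [series (a n * z ^+ n : R[i]^o)]_n @ \oo --> (f z : R[i]^o).

(* For 0 < r < 1 and [f] continuous on the circle |z| = r, which is compact and
   nonempty, this infimum is attained. *)
Definition min_modulus f (r : R) : \bar R :=
  ereal_inf [set (normc (f z))%:E | z in [set z | normc z = r]].

Definition strongly_annular f :=
  analytic_in_disc f /\ limf_esup (min_modulus f) 1^'- = +oo%E.

(* Terms are nonnegative, so these series always have a value in [0, +oo]. *)
Definition ell p : set (nat -> R[i]) :=
  [set a | (\sum_(0 <= n <oo) (normc (a n) `^ p)%:E < +oo)%E].

Definition ell_tilde p : set (nat -> R[i]) :=
  [set a | (\sum_(0 <= k <oo)
    (Num.min (normc (a k.*2) `^ p) (normc (a k.*2.+1) `^ p))%:E < +oo)%E].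

End annular.

(* Main.v *)
Require Import Defs.
From HB Require Import structures.
From mathcomp Require Import all_boot all_order all_algebra.
From mathcomp Require Import all_classical all_reals all_analysis.
From mathcomp Require Import complex.
From mathcomp Require Import ring lra.

Set Implicit Arguments.
Unset Strict Implicit.
Unset Printing Implicit Defensive.

Import Order.TTheory GRing.Theory Num.Theory numFieldNormedType.Exports.
Import Normc.

Local Open Scope classical_set_scope.
Local Open Scope ring_scope.

(** The coefficient sequence is built block by block, so that the partial sum of
    the series after block [j] is at least [j] in modulus on the circle of
    radius [r_j], with [r_j] tending to [1], while the remainder of the series
    is at most [1] there. A block has to be large on the whole unit circle
    although its coefficients are small in the [q]-th power sum; since [q > 2]
    this is possible, and the reason is a perturbation of a monomial.

    On [|z| = 1] put [z = exp (i t)] and consider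
      [w = 1 + e (z - 1/z) + e^2 (z^2 + z^-2) / 2
         = (1 + e^2 cos 2t) + 2 i e sin t].
    The quadratic term is chosen to make the part of order [e^2] of [|w|^2]
    constant: [|w|^2 = 1 + 2 e^2 + e^4 (cos 2t)^2 >= 1 + 2 e^2]. Hence the
    minimum modulus to the power [q] exceeds [1] by at least [2 e^2], while
    the sum of the [q]-th powers of the coefficients exceeds [1] only by
    [2 e^q + 2 (e^2/2)^q], which is smaller for small [e] precisely because
    [q > 2] ([flat_seed], applied to the polynomial [z^2 w] of degree four).
    Multiplying the dilated polynomials [P(z) P(z^5) P(z^25)...] turns this
    strict inequality into an arbitrarily large ratio, because no two products
    of monomials collide: both the power sum and the lower bound are
    multiplicative. After rescaling, the power sum is as small, and the minimum
    modulus as large, as wanted ([flat_small]).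

    To leave [ell_tilde p], each block starts with a constant stretch of [2 L]
    coefficients [L^(-1/p)]: this adds [1] to the sum over pairs, and only
    [2 L^(1 - q/p)] to the [q]-th power sum, which is small for [L] large as
    [p < q] ([pair_block]). The flat polynomial after it is chosen so large that
    it dominates this stretch and all the preceding blocks ([annular_step]).
    A long run of zeros then pushes the following blocks so far that, all
    coefficients having modulus at most [1], their total contribution on the
    circle of radius [r_j] is at most [1]. *)

Section AnnularFunctions.
Variable R : realType.
Implicit Types (z w : R[i]) (a b c : nat -> R[i]) (f : R[i] -> R[i]).

(** * The modulus and finite coefficient sequences *)

Lemma normcEabs z : `|z| = (normc z)%:C%C.
Proof. by case: z. Qed.

Lemma normc_ge0 z : 0 <= normc z.
Proof. by case: z => x y; exact: sqrtr_ge0. Qed.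

Lemma normc_triangle z w : normc (z + w) <= normc z + normc w.
Proof. exact: le_normcD. Qed.

Lemma normc_opp z : normc (- z) = normc z.
Proof. exact: normcN. Qed.

Lemma normc_lower z w : normc w - normc z <= normc (z + w).
Proof.
rewrite lerBlDr; have := normc_triangle (z + w) (- z).
by rewrite normc_opp addrAC subrr add0r.
Qed.

Lemma normcX z n : normc (z ^+ n) = normc z ^+ n.
Proof.
elim: n => [|n IH]; first by rewrite !expr0 normc1.
by rewrite !exprS normcM IH.
Qed.

Lemma normc_real (x : R) : normc (x%:C)%C = `|x|.
Proof. by rewrite /normc /= expr0n addr0 sqrtr_sqr. Qed.

Lemma normc_sum m n (u : nat -> R[i]) :
  normc (\sum_(m <= k < n) u k) <= \sum_(m <= k < n) normc (u k).
Proof.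
elim/big_ind2: _ => [|x1 x2 y1 y2 h1 h2|//]; first by rewrite normc0.
exact: le_trans (normc_triangle _ _) (lerD h1 h2).
Qed.

Lemma normc_sqr z : normc z ^+ 2 = complex.Re z ^+ 2 + complex.Im z ^+ 2.
Proof. by case: z => x y; rewrite /normc sqr_sqrtr// addr_ge0 ?sqr_ge0. Qed.

Definition poly_eval c n z := \sum_(0 <= k < n) c k * z ^+ k.

Definition power_sum (q : R) c n := \sum_(0 <= k < n) normc (c k) `^ q.

Definition pair_sum (p : R) c n :=
  \sum_(0 <= k < n) Num.min (normc (c k.*2) `^ p) (normc (c k.*2.+1) `^ p).

(** * Polynomials flat from below on the unit circle *)

(** The perturbation of [1] is multiplied by [z^2] to have no negative powers. *)
Definition flat_coef (e : R) (n : nat) : R[i] :=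
  nth 0 [:: (e ^+ 2 / 2)%:C; (- e)%:C; 1; e%:C; (e ^+ 2 / 2)%:C]%C n.

(** With [z = x + i y] on the unit circle, [z - 1/z = 2 i y] and
    [z^2 + z^-2 = 2 (x^2 - y^2)]. The cross term [2 e^2 (x^2 - y^2)] of the
    squared real part and the squared imaginary part [4 e^2 y^2] add up to the
    constant [2 e^2]. *)
Lemma flat_coef_lower (e : R) z : normc z = 1 ->
  Num.sqrt (1 + 2 * e ^+ 2) <= normc (poly_eval (flat_coef e) 5 z).
Proof.
case: z => x y z1.
have xy1 : x ^+ 2 + y ^+ 2 = 1 by rewrite -(normc_sqr (x +i* y)%C) z1 expr1n.
pose w : R[i] := ((1 + e ^+ 2 * (x ^+ 2 - y ^+ 2)) +i* (2 * e * y))%C.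
have -> : poly_eval (flat_coef e) 5 (x +i* y)%C = (x +i* y)%C ^+ 2 * w.
  rewrite /poly_eval /flat_coef !big_nat_recl// big_geq//=.
  (* With these powers of [x^2 + y^2 = 1] inserted, the two sides agree as
     polynomials in [x], [y] and [e]. *)
  transitivity ((e ^+ 2 / 2 * (x ^+ 2 + y ^+ 2) ^+ 2)%:C%C +
    (- e * (x ^+ 2 + y ^+ 2))%:C%C * (x +i* y)%C + (x +i* y)%C ^+ 2 +
    e%:C%C * (x +i* y)%C ^+ 3 + (e ^+ 2 / 2)%:C%C * (x +i* y)%C ^+ 4).
    by rewrite xy1 expr1n !mulr1 expr1 mul1r addr0 !addrA.
  apply/eqP; rewrite /w eq_complex !exprS !expr0 !mulr1 /=.
  by apply/andP; split; apply/eqP; field.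
rewrite normcM normcX z1 expr1n mul1r.
rewrite -(ler_pXn2r (n := 2)) ?nnegrE ?sqrtr_ge0 ?normc_ge0//.
rewrite sqr_sqrtr; last by nra.
rewrite normc_sqr /=.
have -> : x ^+ 2 = 1 - y ^+ 2 by rewrite -xy1 addrK.
have := sqr_ge0 (e ^+ 2 * (1 - 2 * y ^+ 2)).
by nra.
Qed.

Lemma flat_coef_power_sum (e q : R) : 0 <= e ->
  power_sum q (flat_coef e) 5 = 1 + 2 * e `^ q + 2 * (e ^+ 2 / 2) `^ q.
Proof.
move=> e0; have e20 : 0 <= e ^+ 2 / 2 by rewrite divr_ge0 ?sqr_ge0.
rewrite /power_sum /flat_coef !big_nat_recl// big_geq//=.
rewrite !expr0n /= expr1n !addr0 sqrtr1 powR1 !sqrtr_sqr normrN !ger0_norm//.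
ring.
Qed.

(** For [q = 2] the strict inequality would contradict Parseval's identity. For
    [q > 2] choose [e <= 1] with [e^q = e^2/2]: the gain [2 e^2] of the minimum
    beats the loss [2 e^q + 2 (e^2/2)^q], which is at most [e^2 + e^2/2]. *)
Lemma flat_seed (q : R) : 2 < q ->
  exists b d m, [/\ (0 < d)%N, 0 < m, power_sum q b d < m `^ q &
    forall z, normc z = 1 -> m <= normc (poly_eval b d z)].
Proof.
move=> q2; have q20 : 0 < q - 2 by rewrite subr_gt0.
pose e : R := 2^-1 `^ (q - 2)^-1.
have e0 : 0 < e by rewrite powR_gt0// invr_gt0.
have h1 : (0 < 2^-1 :> R) && (2^-1 <= 1 :> R).
  by rewrite invr_gt0 ltr0n /= invf_le1 ?ler1n ?ltr0n.
have e1 : e <= 1.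
  rewrite -[leRHS](powRr0 (2^-1)) ger_powR// invr_ge0; exact: ltW.
have eq : e `^ q = e ^+ 2 / 2.
  have -> : q = 2%:R + (q - 2) by lra.
  rewrite powRD; last by rewrite (gt_eqF e0) implybT.
  rewrite powR_mulrn ?(ltW e0)//; congr (_ * _).
  by rewrite /e -powRrM mulVf ?gt_eqF// powRr1// invr_ge0.
exists (flat_coef e), 5, (Num.sqrt (1 + 2 * e ^+ 2)); split=> //.
- by rewrite sqrtr_gt0; nra.
- have e2 : 0 < e ^+ 2 <= 1 by rewrite exprn_gt0 ?exprn_ile1 ?(ltW e0).
  rewrite flat_coef_power_sum ?(ltW e0)// eq.
  have l1 : (e ^+ 2 / 2) `^ q <= (e ^+ 2 / 2) ^+ 2.
    rewrite -[leRHS]powR_mulrn; last by lra.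
    by rewrite ger_powR// ?(ltW q2)//; apply/andP; split; lra.
  have s1 : 1 <= Num.sqrt (1 + 2 * e ^+ 2).
    by rewrite -[leLHS]sqrtr1 ler_wsqrtr//; nra.
  have l2 : (e ^+ 2 / 2) ^+ 2 <= e ^+ 2 / 4.
    by move: (e ^+ 2) e2 => x /andP[? ?]; nra.
  apply: (@lt_le_trans _ _ (1 + 2 * e ^+ 2)).
    by move: e2 => /andP[e20 e21]; lra.
  rewrite -[leLHS]sqr_sqrtr; last by nra.
  (* The base is at least [1], so its power [q] dominates its square. *)
  by rewrite -[leLHS]powR_mulrn ?sqrtr_ge0// ler_powR// ltW.
- exact: flat_coef_lower.
Qed.

(** The coefficients of [B(z) C(z^d)] when [B] has degree less than [d]: every
    index is uniquely of the form [j + d i] with [j < d]. *)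
Definition kron_coef b d c (n : nat) := b (n %% d)%N * c (n %/ d)%N.

Lemma sum_block (V : nmodType) d N (F : nat -> V) :
  \sum_(0 <= n < N * d) F n =
  \sum_(0 <= i < N) \sum_(0 <= j < d) F (i * d + j)%N.
Proof.
rewrite big_nat_mul; apply: eq_bigr => i _.
rewrite -{1}[(i * d)%N]add0n big_addn mulSn addnK.
by apply: eq_bigr => j _; rewrite addnC.
Qed.

Lemma kron_power_sum (q : R) b d c N : power_sum q (kron_coef b d c) (N * d) =
  power_sum q b d * power_sum q c N.
Proof.
rewrite /power_sum sum_block mulrC mulr_suml; apply: eq_bigr => i _.
rewrite mulr_sumr; apply: eq_big_nat => j /andP[_ jd].
have d0 : (0 < d)%N by exact: leq_ltn_trans jd.
by rewrite /kron_coef modnMDl modn_small// divnMDl// divn_small// addn0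
  normcM powRM ?normc_ge0// mulrC.
Qed.

Lemma kron_eval b d c N z : poly_eval (kron_coef b d c) (N * d) z =
  poly_eval b d z * poly_eval c N (z ^+ d).
Proof.
rewrite /poly_eval sum_block mulrC mulr_suml; apply: eq_bigr => i _.
rewrite mulr_sumr; apply: eq_big_nat => j /andP[_ jd].
have d0 : (0 < d)%N by exact: leq_ltn_trans jd.
rewrite /kron_coef modnMDl modn_small// divnMDl// divn_small// addn0.
by rewrite exprD mulnC exprM; ring.
Qed.

(** Both the power sum and the lower bound are multiplicative under
    [P(z) C(z^d)]; the lower bound because [z^d] stays on the unit circle. *)
Lemma flat_powers (q : R) b d m : (0 < d)%N -> 0 < m ->
  (forall z, normc z = 1 -> m <= normc (poly_eval b d z)) ->
  forall k, exists c N, power_sum q c N = power_sum q b d ^+ k /\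
    forall z, normc z = 1 -> m ^+ k <= normc (poly_eval c N z).
Proof.
move=> d0 m0 bm; elim=> [|k [c [N [cN cm]]]].
  exists (fun=> 1), 1%N; rewrite /power_sum /poly_eval !big_nat1 normc1 powR1.
  by split=> // z _; rewrite !expr0 big_nat1 mulr1 normc1.
exists (kron_coef b d c), (N * d)%N; rewrite kron_power_sum cN exprS.
split=> // z z1; rewrite kron_eval normcM exprS.
rewrite ler_pM ?exprn_ge0 ?(ltW m0)// ?bm// cm//.
by rewrite normcX z1 expr1n.
Qed.

Lemma scale_power_sum (q s : R) c N : 0 <= s ->
  power_sum q (fun n => s%:C%C * c n) N = s `^ q * power_sum q c N.
Proof.
move=> s0; rewrite /power_sum mulr_sumr; apply: eq_bigr => i _.
by rewrite normcM powRM ?normc_ge0// normc_real ger0_norm.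
Qed.

Lemma scale_eval (s : R) c N z :
  poly_eval (fun n => s%:C%C * c n) N z = s%:C%C * poly_eval c N z.
Proof. by rewrite /poly_eval mulr_sumr; apply: eq_bigr => i _; rewrite mulrA. Qed.

(** The [k]-th product has power sum [K^k] and minimum at least [m^k], where
    [K < m^q]. Rescaled to have minimum [M], its power sum is
    [M^q (K / m^q)^k], which tends to zero. *)
Lemma flat_small (q e M : R) : 2 < q -> 0 < e -> 0 < M ->
  exists c N, power_sum q c N <= e /\
    forall z, normc z = 1 -> M <= normc (poly_eval c N z).
Proof.
move=> q2 e0 M0; have [b [d [m [d0 m0 bs bm]]]] := flat_seed q2.
set K := power_sum q b d in bs.
have K0 : 0 <= K by apply: sumr_ge0 => i _; exact: powR_ge0.
have mq : 0 < m `^ q by exact: powR_gt0.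
have rho1 : `|K / m `^ q| < 1.
  by rewrite ger0_norm ?divr_ge0 ?(ltW mq)// ltr_pdivrMr// mul1r.
have [k kP] : exists k, M `^ q * (K / m `^ q) ^+ k <= e.
  have /cvgrPdist_le/(_ _ e0)[k _ /(_ k (leqnn k))] := cvg_geometric (M `^ q) rho1.
  rewrite /= sub0r normrN => h; exists k; exact: le_trans (ler_norm _) h.
have [c [N [cN cm]]] := flat_powers q d0 m0 bm k.
have mk : 0 < m ^+ k by exact: exprn_gt0.
have s0 : 0 <= M / m ^+ k by rewrite divr_ge0 ?(ltW M0) ?(ltW mk).
exists (fun n => (M / m ^+ k)%:C%C * c n), N; split.
- rewrite scale_power_sum// cN; apply: le_trans kP.
  rewrite powRM ?invr_ge0 ?(ltW M0) ?(ltW mk)// -mulrA expr_div_n.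
  rewrite ler_pM2l ?powR_gt0// mulrC ler_wpM2l ?exprn_ge0//.
  rewrite -[m ^+ k]powR_mulrn ?(ltW m0)// -powRN -powRrM.
  rewrite -[(m `^ q) ^+ k]powR_mulrn ?(ltW mq)// -powRrM -powRN.
  by rewrite mulNr (mulrC q).
- move=> z z1; rewrite scale_eval normcM normc_real ger0_norm//.
  apply: le_trans (ler_wpM2l s0 (cm z z1)).
  by rewrite mulfVK ?gt_eqF.
Qed.

(** * Concatenating finite coefficient sequences *)

Definition concat_coef n c c' (k : nat) := if (k < n)%N then c k else c' (k - n)%N.

Lemma concat_sum (V : nmodType) (F : nat -> R[i] -> V) n m c c' :
  \sum_(0 <= k < n + m) F k (concat_coef n c c' k) =
  \sum_(0 <= k < n) F k (c k) + \sum_(0 <= k < m) F (n + k)%N (c' k).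
Proof.
rewrite (big_cat_nat (n := n))//= ?leq_addr//; congr (_ + _).
  by apply: eq_big_nat => k /andP[_ kn]; rewrite /concat_coef kn.
rewrite -{1}[n]add0n big_addn addKn; apply: eq_bigr => k _.
by rewrite /concat_coef ltnNge leq_addl /= addnK addnC.
Qed.

Lemma concat_power_sum (q : R) n m c c' :
  power_sum q (concat_coef n c c') (n + m) = power_sum q c n + power_sum q c' m.
Proof. exact: (concat_sum (fun _ x => normc x `^ q)). Qed.

Lemma concat_eval n m c c' z :
  poly_eval (concat_coef n c c') (n + m) z =
  poly_eval c n z + z ^+ n * poly_eval c' m z.
Proof.
rewrite /poly_eval (concat_sum (fun k x => x * z ^+ k)); congr (_ + _).
by rewrite mulr_sumr; apply: eq_bigr => k _; rewrite exprD mulrCA.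
Qed.

Lemma concat_pair_sum (p : R) n m c c' :
  pair_sum p (concat_coef n.*2 c c') (n + m) = pair_sum p c n + pair_sum p c' m.
Proof.
rewrite /pair_sum (big_cat_nat (n := n))//= ?leq_addr//; congr (_ + _).
  apply: eq_big_nat => k /andP[_ kn].
  by rewrite /concat_coef ltn_double ltn_Sdouble kn.
rewrite -{1}[n]add0n big_addn addKn; apply: eq_bigr => k _.
rewrite /concat_coef ltn_double ltn_Sdouble ltnNge leq_addl /= doubleD addnK.
by rewrite -addSn addnK.
Qed.

Lemma pair_sum_ge0 (p : R) c n : 0 <= pair_sum p c n.
Proof. by apply: sumr_ge0 => k _; rewrite le_min !powR_ge0. Qed.

Lemma zero_power_sum (q : R) n : 0 < q -> power_sum q (fun=> 0) n = 0.
Proof.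
by move=> q0; rewrite /power_sum big1// => k _; rewrite normc0 powR0// gt_eqF.
Qed.

Lemma zero_eval n z : poly_eval (fun=> 0) n z = 0.
Proof. by rewrite /poly_eval big1// => k _; rewrite mul0r. Qed.

Lemma eval_bound c n z : normc z <= 1 ->
  normc (poly_eval c n z) <= \sum_(0 <= k < n) normc (c k).
Proof.
move=> z1; apply: le_trans (normc_sum _ _ _) _; apply: ler_sum => k _.
by rewrite normcM normcX ler_piMr ?normc_ge0// exprn_ile1 ?normc_ge0.
Qed.

(** A constant stretch of [2 L] coefficients [L^(-1/p)] has pair sum exactly [1]
    and power sum [2 L^(-s)] with [s = q/p - 1 > 0]. *)
Lemma pair_block (p q e : R) : 0 < p -> p < q -> 0 < e ->
  exists c n, power_sum q c n.*2 <= e /\ 1 <= pair_sum p c n.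
Proof.
move=> p0 pq e0; pose s := q / p - 1.
have s0 : 0 < s by rewrite subr_gt0 ltr_pdivlMr// mul1r.
pose L := (Num.truncn ((2 / e) `^ s^-1)).+1.
have L0 : 0 < L%:R :> R by rewrite ltr0n.
have Lp : (2 / e) `^ s^-1 <= L%:R.
  by apply: ltW; apply: truncnS_gt.
have L2 : 2 / e <= L%:R `^ s.
  have e2 : 0 <= 2 / e by rewrite divr_ge0 ?(ltW e0).
  rewrite -[leLHS](powRr1 e2) -[X in _ `^ X <= _](mulVf (lt0r_neq0 s0)) powRrM.
  by apply: ge0_ler_powR; rewrite ?nnegrE ?powR_ge0 ?(ltW s0) ?(ltW L0).
pose d : R := L%:R `^ (- p^-1).
exists (fun=> d%:C%C), L.
rewrite /power_sum /pair_sum !sumr_const_nat !subn0 normc_real ger0_norm ?powR_ge0//.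
rewrite minxx /d -!powRrM !mulNr mulVf ?gt_eqF// powR_inv1 ?(ltW L0)//.
split; last first.
  by rewrite -[leRHS]mulr_natr mulVf ?gt_eqF.
have key : L%:R `^ (- (p^-1 * q)) * L%:R = (L%:R `^ s)^-1.
  rewrite -[X in _ * X]powRr1 ?(ltW L0)// -powRD.
    2: by rewrite (gt_eqF L0) implybT.
  by rewrite -powRN; congr (_ `^ _); rewrite /s; ring.
rewrite -mul2n mulrnA -[leLHS]mulr_natr -[X in X * _ <= _]mulr_natr mulrAC key.
by rewrite ler_pdivrMl ?powR_gt0// mulrC -ler_pdivrMl// mulrC.
Qed.

(** A constant stretch followed by a flat polynomial chosen after it, so large
    that it dominates the stretch on the unit circle. *)
Lemma annular_block (p q e M : R) : 2 <= p -> p < q -> 0 < e -> 0 < M ->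
  exists c n, [/\ power_sum q c n.*2 <= e, 1 <= pair_sum p c n &
    forall z, normc z = 1 -> M <= normc (poly_eval c n.*2 z)].
Proof.
move=> p2 pq e0 M0; have q2 : 2 < q by exact: le_lt_trans pq.
have p0 : 0 < p by exact: lt_le_trans p2.
have e20 : 0 < e / 2 by rewrite divr_gt0.
have [h [l [hq hp]]] := pair_block p0 pq e20.
pose S := \sum_(0 <= k < l.*2) normc (h k).
have S0 : 0 <= S by apply: sumr_ge0 => k _; exact: normc_ge0.
have [g [n [gq gM]]] := flat_small q2 e20 (ltr_pwDl M0 S0).
(* The zeros make the length of the flat polynomial even, which keeps all block
   boundaries aligned with the pairs [(2k, 2k+1)]. *)
exists (concat_coef l.*2 h (concat_coef n g (fun=> 0))), (l + n)%N.
rewrite concat_pair_sum doubleD concat_power_sum -[n.*2]addnn concat_power_sum.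
rewrite zero_power_sum ?(lt_trans _ q2)// addr0; split.
- by rewrite [leRHS]splitr lerD.
- by rewrite ler_wpDr ?pair_sum_ge0.
move=> z z1; rewrite concat_eval concat_eval zero_eval mulr0 addr0.
apply: le_trans (normc_lower _ _); rewrite lerBrDr.
rewrite normcM normcX z1 expr1n mul1r.
by apply: le_trans (gM z z1); rewrite lerD2l eval_bound ?z1.
Qed.

(** * The inductive construction *)

Lemma one_sub_exp_le (r : R) k : 0 <= r <= 1 -> 1 - r ^+ k <= k%:R * (1 - r).
Proof.
move=> /andP[r0 r1]; elim: k => [|k IH]; first by rewrite expr0 subrr mul0r.
have h : r ^+ k <= 1 by rewrite exprn_ile1.
have h0 : 0 <= 1 - r by rewrite subr_ge0.
rewrite exprSr -natr1 mulrDl mul1r; nra.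
Qed.

Lemma eval_radial c n (r : R) w : 0 <= r <= 1 -> normc w = 1 ->
  normc (poly_eval c n w - poly_eval c n (r%:C%C * w)) <=
  (1 - r) * \sum_(0 <= k < n) normc (c k) * k%:R.
Proof.
move=> r01 w1; rewrite /poly_eval -sumrB mulr_sumr.
apply: le_trans (normc_sum _ _ _) _; apply: ler_sum => k _.
rewrite -mulrBr exprMn -[X in X - _]mul1r -mulrBl !normcM normcX w1 expr1n mulr1.
have -> : 1 - r%:C%C ^+ k = (1 - r ^+ k)%:C%C :> R[i].
  by rewrite rmorphB rmorph1 rmorphXn.
move: (r01) => /andP[r0 r1].
rewrite normc_real ger0_norm ?subr_ge0 ?exprn_ile1// mulrCA.
by rewrite ler_wpM2l ?normc_ge0// mulrC one_sub_exp_le.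
Qed.

Lemma exp_small (r e : R) : 0 <= r < 1 -> 0 < e -> exists n, r ^+ n <= e.
Proof.
move=> /andP[r0 r1] e0.
have nr : `|r| < 1 by rewrite ger0_norm.
have /cvgrPdist_le/(_ _ e0)[k _ /(_ k (leqnn k))] := cvg_geometric 1 nr.
by rewrite /= sub0r normrN mul1r => h; exists k; exact: le_trans (ler_norm _) h.
Qed.

(** The new block is chosen so large on the unit circle that it dominates
    everything before it, with one unit to spare, which pays for moving to a
    slightly smaller circle of radius [r]. Trailing zeros give
    [r ^ (2 n') <= 1 - r], so that [r ^ (2 n') + r ^ (2 n' + 1) + ...] is at
    most [1]. *)
Lemma annular_step (p q e M r0 : R) c n : 2 <= p -> p < q -> 0 < e -> 0 < M ->
  0 < r0 < 1 ->
  exists c' n' r, [/\ (n < n')%N, (forall k, (k < n.*2)%N -> c' k = c k),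
    power_sum q c' n'.*2 <= power_sum q c n.*2 + e,
    pair_sum p c n + 1 <= pair_sum p c' n' &
    [/\ r0 <= r < 1, r ^+ n'.*2 <= 1 - r &
     forall z, normc z = r -> M <= normc (poly_eval c' n'.*2 z)]].
Proof.
move=> p2 pq e0 M0 /andP[r00 r01].
have q0 : 0 < q by apply: lt_trans pq; exact: lt_le_trans p2.
pose S := \sum_(0 <= k < n.*2) normc (c k).
have S0 : 0 <= S by apply: sumr_ge0 => k _; exact: normc_ge0.
have M1 : 0 < M + 1 + S by rewrite !ltr_pwDl.
have [g [m [gq gp gM]]] := annular_block p2 pq e0 M1.
pose c1 := concat_coef n.*2 c g.
have c1M z : normc z = 1 -> M + 1 <= normc (poly_eval c1 (n + m).*2 z).
  move=> z1; rewrite doubleD concat_eval.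
  apply: le_trans (normc_lower _ _); rewrite lerBrDr.
  rewrite normcM normcX z1 expr1n mul1r.
  by apply: le_trans (gM z z1); rewrite lerD2l eval_bound ?z1.
(* By [eval_radial], [D] is a Lipschitz constant in the radial direction. *)
pose D := \sum_(0 <= k < (n + m).*2) normc (c1 k) * k%:R.
have D0 : 0 <= D by apply: sumr_ge0 => k _; rewrite mulr_ge0 ?normc_ge0.
pose d : R := Num.min (1 - r0) (D + 1)^-1.
have d0 : 0 < d by rewrite lt_min subr_gt0 r01 invr_gt0 ltr_wpDl.
have dr : d <= 1 - r0 by rewrite ge_min lexx.
have dD : d * D <= 1.
  apply: (@le_trans _ _ ((D + 1)^-1 * D)).
    by rewrite ler_wpM2r// ge_min lexx orbT.
  by rewrite ler_pdivrMl ?ltr_wpDl// mulr1 lerDl.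
pose r := 1 - d; have r1d : 1 - r = d by rewrite subKr.
have rr : r0 <= r < 1 by apply/andP; split; rewrite /r; lra.
have r0' : 0 <= r < 1 by apply/andP; split; rewrite /r; lra.
have [t tP] := exp_small r0' d0.
exists (concat_coef (n + m).*2 c1 (fun=> 0)), (n + m + t.+1)%N, r; split.
- by rewrite addnS ltnS -addnA leq_addr.
- move=> k kn; rewrite /concat_coef (leq_trans kn) ?leq_double ?leq_addr//.
  by rewrite /c1 /concat_coef kn.
- rewrite [(n + m + _).*2]doubleD concat_power_sum zero_power_sum// addr0.
  by rewrite doubleD concat_power_sum lerD2l.
- rewrite concat_pair_sum concat_pair_sum ler_wpDr ?pair_sum_ge0//.
  by rewrite lerD2l.
split=> //.
  rewrite r1d; apply: le_trans tP.
  move: r0' => /andP[r_ge0 r_lt1]; rewrite ler_wiXn2l ?(ltW r_lt1)//.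
  by rewrite -addnn (leq_trans _ (leq_addr _ _))// addnS leqW// leq_addl.
move=> z zr; rewrite [(n + m + _).*2]doubleD concat_eval zero_eval mulr0 addr0.
have r_gt0 : 0 < r by move: rr => /andP[h _]; exact: lt_le_trans h.
have rC : r%:C%C * (r^-1)%:C%C = 1 :> R[i] by rewrite -rmorphM divff ?gt_eqF.
pose w := (r^-1)%:C%C * z.
have w1 : normc w = 1.
  by rewrite normcM normc_real gtr0_norm ?invr_gt0// zr mulVf ?gt_eqF.
have r01' : 0 <= r <= 1 by move: r0' => /andP[-> /ltW].
have := eval_radial c1 (n + m).*2 r01' w1; rewrite /w mulrA rC mul1r -/D -/w.
rewrite r1d => /le_trans/(_ dD).
rewrite -normc_opp opprB => near.
have := normc_lower (poly_eval c1 (n + m).*2 z - poly_eval c1 (n + m).*2 w)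
  (poly_eval c1 (n + m).*2 w).
by rewrite subrK; have := c1M w w1; lra.
Qed.

Lemma power_sum_le (q : R) c m n : (m <= n)%N -> power_sum q c m <= power_sum q c n.
Proof.
move=> mn; rewrite /power_sum [leRHS](big_cat_nat (n := m))//= lerDl.
by apply: sumr_ge0 => k _; exact: powR_ge0.
Qed.

Lemma eq_power_sum (q : R) c c' n : (forall k, (k < n)%N -> c k = c' k) ->
  power_sum q c n = power_sum q c' n.
Proof. by move=> cc'; apply: eq_big_nat => k /andP[_ kn]; rewrite cc'. Qed.

Lemma eq_poly_eval c c' n z : (forall k, (k < n)%N -> c k = c' k) ->
  poly_eval c n z = poly_eval c' n z.
Proof. by move=> cc'; apply: eq_big_nat => k /andP[_ kn]; rewrite cc'. Qed.

Lemma eq_pair_sum (p : R) c c' n : (forall k, (k < n.*2)%N -> c k = c' k) ->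
  pair_sum p c n = pair_sum p c' n.
Proof.
move=> cc'; apply: eq_big_nat => k /andP[_ kn].
by rewrite !cc'// ?ltn_double// ltn_Sdouble.
Qed.

(** Each application of [annular_step] may use [2^-(j+1)] of the power sum, so
    that the total is at most [1]. *)
Lemma annular_coefficients (p q : R) : 2 <= p -> p < q ->
  exists a (n_ : nat -> nat) (r_ : nat -> R),
  [/\ forall N, power_sum q a N <= 1,
      forall j, j%:R <= pair_sum p a (n_ j) &
      forall j, [/\ 1 - j.+2%:R^-1 <= r_ j < 1,
        r_ j ^+ (n_ j).*2 <= 1 - r_ j &
        forall z, normc z = r_ j -> j%:R <= normc (poly_eval a (n_ j).*2 z)]].
Proof.
move=> p2 pq.
pose step (x : nat * ((nat -> R[i]) * nat * R)) (y : (nat -> R[i]) * nat * R) :=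
  let: (j, (c, n, _)) := x in let: (c', n', r) := y in
  [/\ (n < n')%N, (forall k, (k < n.*2)%N -> c' k = c k),
    power_sum q c' n'.*2 <= power_sum q c n.*2 + 2^-1 ^+ j.+1,
    pair_sum p c n + 1 <= pair_sum p c' n' &
    [/\ 1 - j.+2%:R^-1 <= r < 1, r ^+ n'.*2 <= 1 - r &
     forall z, normc z = r -> j.+1%:R <= normc (poly_eval c' n'.*2 z)]].
have [F FP] : {F & forall x, step x (F x)}.
  apply: choice => -[j [[c n] r]].
  have j2 : (0 < 1 - j.+2%:R^-1 :> R) && (1 - j.+2%:R^-1 < 1 :> R).
    by rewrite subr_gt0 invf_lt1 ?ltr0n// ltr1n /= gtrBl invr_gt0 ltr0n.
  have e0 : 0 < 2^-1 ^+ j.+1 :> R by rewrite exprn_gt0// invr_gt0 ltr0n.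
  have M0 : 0 < j.+1%:R :> R by rewrite ltr0n.
  have [c' [n' [r' ?]]] := annular_step c n p2 pq e0 M0 j2.
  by exists (c', n', r').
pose st := fix st j := if j is j'.+1 then F (j', st j') else (fun=> 0, 0%N, 0).
pose c_ j := (st j).1.1; pose n_ j := (st j).1.2; pose r_ j := (st j).2.
have stP j : step (j, (c_ j, n_ j, r_ j)) (c_ j.+1, n_ j.+1, r_ j.+1).
  have := FP (j, st j); rewrite /c_ /n_ /r_ /=.
  by case: (st j) => [[? ?] ?]; case: (F _) => [[? ?] ?].
have n_homo j i : (n_ j <= n_ (j + i))%N.
  elim: i => [|i IH]; first by rewrite addn0.
  by apply: leq_trans IH _; rewrite addnS; case: (stP (j + i)%N) => /ltnW.
have n_ge j : (j <= n_ j)%N.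
  by elim: j => // j IH; case: (stP j) => h _ _ _ _; exact: leq_ltn_trans IH h.
have agree j i k : (k < (n_ j).*2)%N -> c_ (j + i)%N k = c_ j k.
  move=> kj; elim: i => [|i IH]; first by rewrite addn0.
  rewrite -IH addnS; case: (stP (j + i)%N) => _ -> //.
  by apply: leq_trans kj _; rewrite leq_double.
(* The stage [k + 1] has length more than [k], so entry [k] is final there. *)
pose a k := c_ k.+1 k.
have aE j k : (k < (n_ j).*2)%N -> a k = c_ j k.
  move=> kj; rewrite -(agree j k.+1)// addnC agree//.
  by rewrite -addnn ltn_addr.
have c_sum j : power_sum q (c_ j) (n_ j).*2 <= 1 - 2^-1 ^+ j.
  elim: j => [|j IH]; first by rewrite /power_sum big_geq// expr0 subrr.
  case: (stP j) => _ _ /le_trans h _ _; apply: h.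
  rewrite -lerBrDr; apply: le_trans IH _; rewrite exprS; lra.
have c_pair j : j%:R <= pair_sum p (c_ j) (n_ j).
  elim: j => [|j IH]; first exact: pair_sum_ge0.
  by case: (stP j) => _ _ _ h _; apply: le_trans h; rewrite -natr1 lerD2r.
exists a, (fun j => n_ j.+1), (fun j => r_ j.+1); split.
- move=> N; apply: (@le_trans _ _ (power_sum q a (n_ N).*2)).
    by rewrite power_sum_le// -addnn (leq_trans (n_ge N))// leq_addr.
  rewrite (eq_power_sum q (aE N)).
  by apply: le_trans (c_sum N) _; rewrite gerBl exprn_ge0// invr_ge0.
- move=> j; rewrite (eq_pair_sum p (aE j.+1)).
  by apply: le_trans (c_pair j.+1); rewrite ler_nat.
- move=> j; case: (stP j) => _ _ _ _ [? ? h]; split=> // z zr.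
  rewrite (eq_poly_eval z (aE j.+1)).
  by apply: le_trans (h z zr); rewrite ler_nat.
Qed.

(** * Complex power series with bounded coefficients *)

(** A positive [e : R[i]] is a positive real number, so convergence in [R[i]^o]
    can be tested with real tolerances on [normc]. *)
Lemma complex_cvgP (u : nat -> R[i]) (l : R[i]) :
  ((u : nat -> R[i]^o) @ \oo --> (l : R[i]^o)) <->
  forall e : R, 0 < e -> exists N, forall n, (N <= n)%N -> normc (l - u n) <= e.
Proof.
split.
- move=> /cvgrPdist_le ul e e0.
  have /ul[N _ NP] : 0 < e%:C%C :> R[i] by rewrite ltcR.
  exists N => n /NP /=; by rewrite normcEabs lecR.
- move=> ul; apply/cvgrPdist_le => e e0.
  have [er e0'] : e = (complex.Re e)%:C%C /\ 0 < complex.Re e.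
    case: e e0 => x y; rewrite ltcE /= => /andP[/eqP -> x0].
    by split.
  have [N NP] := ul _ e0'.
  exists N => // n /= /NP; by rewrite er normcEabs lecR.
Qed.

Lemma normc_le_ReIm z : normc z <= `|complex.Re z| + `|complex.Im z|.
Proof.
case: z => x y; rewrite [complex.Re _]/= [complex.Im _]/=.
have -> : (x +i* y)%C = x%:C%C + (0 +i* y)%C :> R[i].
  by apply/eqP; rewrite eq_complex /= addr0 add0r !eqxx.
apply: le_trans (normc_triangle _ _) _.
by rewrite normc_real /= expr0n /= add0r sqrtr_sqr.
Qed.

Lemma Re_le_normc z : `|complex.Re z| <= normc z.
Proof. by case: z => x y /=; rewrite -sqrtr_sqr ler_wsqrtr// lerDl sqr_ge0. Qed.

Lemma Im_le_normc z : `|complex.Im z| <= normc z.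
Proof. by case: z => x y /=; rewrite -sqrtr_sqr ler_wsqrtr// lerDr sqr_ge0. Qed.

Lemma real_series_cvg (v : nat -> R) (C : R) :
  (forall n, \sum_(0 <= k < n) `|v k| <= C) -> cvgn (series v).
Proof.
move=> vC; apply: normed_cvg; apply: nondecreasing_is_cvgn.
  by apply: nondecreasing_series => k _ _; exact: normr_ge0.
by exists C => _ [n _ <-]; exact: vC.
Qed.

Lemma Re_sum n (u : nat -> R[i]) :
  complex.Re (\sum_(0 <= k < n) u k) = \sum_(0 <= k < n) complex.Re (u k).
Proof. by apply: (big_morph (@complex.Re R)) => // -[? ?] [? ?]. Qed.

Lemma Im_sum n (u : nat -> R[i]) :
  complex.Im (\sum_(0 <= k < n) u k) = \sum_(0 <= k < n) complex.Im (u k).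
Proof. by apply: (big_morph (@complex.Im R)) => // -[? ?] [? ?]. Qed.

(** Absolute convergence implies convergence, obtained from the completeness of
    [R] applied to the real and imaginary parts. *)
Lemma complex_series_cvg (u : nat -> R[i]) (C : R) :
  (forall n, \sum_(0 <= k < n) normc (u k) <= C) ->
  exists l : R[i],
    ([series (u k : R[i]^o)]_k : nat -> R[i]^o) @ \oo --> (l : R[i]^o).
Proof.
move=> uC.
have /real_series_cvg/cvg_ex[x /cvgrPdist_le ux] n :
    \sum_(0 <= k < n) `|complex.Re (u k)| <= C.
  by apply: le_trans (uC n); apply: ler_sum => k _; exact: Re_le_normc.
have /real_series_cvg/cvg_ex[y /cvgrPdist_le uy] n :
    \sum_(0 <= k < n) `|complex.Im (u k)| <= C.
  by apply: le_trans (uC n); apply: ler_sum => k _; exact: Im_le_normc.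
exists (x +i* y)%C; apply/complex_cvgP => e e0.
have e20 : 0 < e / 2 by rewrite divr_gt0.
have [N _ NP] := ux _ e20; have [M _ MP] := uy _ e20.
exists (maxn N M) => n; rewrite geq_max => /andP[/NP hx /MP hy].
apply: le_trans (normc_le_ReIm _) _; rewrite [leRHS]splitr.
apply: lerD.
- have -> : complex.Re ((x +i* y)%C - series u n) =
      x - series (fun k => complex.Re (u k)) n.
    by rewrite raddfB /= /series /= Re_sum.
  exact: hx.
- have -> : complex.Im ((x +i* y)%C - series u n) =
      y - series (fun k => complex.Im (u k)) n.
    by rewrite raddfB /= /series /= Im_sum.
  exact: hy.
Qed.

Lemma cvg_normc_le (u : nat -> R[i]) (l A : R[i]) (B : R) n0 :
  ((u : nat -> R[i]^o) @ \oo --> (l : R[i]^o)) ->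
  (forall n, (n0 <= n)%N -> normc (u n - A) <= B) -> normc (l - A) <= B.
Proof.
move=> /complex_cvgP ul uB; apply/ler_addgt0Pr => e /ul[N NP].
have -> : l - A = (u (maxn N n0) - A) + (l - u (maxn N n0)) by ring.
apply: le_trans (normc_triangle _ _) (lerD _ _).
  by apply: uB; rewrite leq_maxr.
by apply: NP; rewrite leq_maxl.
Qed.

(** The partial sums of the expansion of [(1 - r)^-(d+1)]; Pascal's rule gives
    [T_(d+1) <= T_d + r T_(d+1)] for these sums. The cases [d = 1] and [d = 2]
    control the first two derivatives of a power series. *)
Lemma binomial_sum_le (r : R) d n : 0 <= r < 1 ->
  \sum_(0 <= k < n) 'C(k, d)%:R * r ^+ (k - d) <= (1 - r)^-1 ^+ d.+1.
Proof.
move=> /andP[r0 r1]; have s0 : 0 < 1 - r by rewrite subr_gt0.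
have s0' : 1 - r != 0 by rewrite gt_eqF.
have i0 m : 0 <= (1 - r)^-1 ^+ m by rewrite exprn_ge0// invr_ge0 ltW.
elim: d n => [|d IHd]; elim=> [|n IHn]; rewrite ?big_nil ?(big_geq (leqnn 0))//.
  rewrite big_nat_recl// bin0 mul1r expr0.
  under eq_bigr do rewrite bin0 mul1r subn0 exprS.
  have geo : \sum_(0 <= k < n) r ^+ k <= (1 - r)^-1 ^+ 1.
    apply: le_trans IHn; apply: ler_sum => k _.
    by rewrite bin0 mul1r subn0.
  rewrite -mulr_sumr; apply: le_trans (lerD (lexx _) (ler_wpM2l r0 geo)) _.
  by rewrite expr1 -[X in X + _](mulfV s0') -mulrDl subrK mul1r.
rewrite big_nat_recl// bin0n mul0r add0r.
rewrite (eq_bigr (fun k => 'C(k, d)%:R * r ^+ (k - d) +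
   r * ('C(k, d.+1)%:R * r ^+ (k - d.+1)))).
  rewrite big_split /= -mulr_sumr.
  apply: le_trans (lerD (IHd n) (ler_wpM2l r0 IHn)) _.
  rewrite [in leRHS]exprS [X in _ + r * X]exprS.
  rewrite -[X in X + _]mul1r -[X in X * _ + _](mulfV s0') mulrA -mulrDl.
  by rewrite -mulrDl subrK mul1r.
move=> k _; rewrite subSS binS natrD addrC mulrDl; congr (_ + _).
have [kd|dk] := leqP k d; first by rewrite bin_small ?ltnS// !mul0r mulr0.
by rewrite mulrCA -exprS subnSK.
Qed.

Lemma expr_diff_bound (r : R) z h k : normc z <= r -> normc (z + h) <= r ->
  normc ((z + h) ^+ k - z ^+ k) <= normc h * ('C(k, 1)%:R * r ^+ (k - 1)).
Proof.
move=> zr zhr; have r0 : 0 <= r by apply: le_trans zr; exact: normc_ge0.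
elim: k => [|k IH]; first by rewrite !expr0 subrr normc0 bin0n mul0r mulr0.
have -> : (z + h) ^+ k.+1 - z ^+ k.+1 =
    z * ((z + h) ^+ k - z ^+ k) + h * (z + h) ^+ k by rewrite !exprS; ring.
apply: le_trans (normc_triangle _ _) _; rewrite !normcM.
have -> : normc h * ('C(k.+1, 1)%:R * r ^+ (k.+1 - 1)) =
    r * (normc h * ('C(k, 1)%:R * r ^+ (k - 1))) + normc h * r ^+ k.
  rewrite !bin1 subn1 /=; case: k {IH} => [|k]; first by rewrite !expr0; ring.
  by rewrite subn1 /= -natr1 exprS; ring.
apply: lerD; first by rewrite ler_pM ?normc_ge0.
by rewrite ler_wpM2l ?normc_ge0// normcX lerXn2r ?nnegrE ?normc_ge0.
Qed.

(** The second order Taylor remainder of [z^k], bounded by [|h|^2] times half the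
    largest second derivative on the disc of radius [r]. The remainders satisfy
    [E_(k+1) = z E_k + h ((z + h)^k - z^k)]. *)
Lemma expr_taylor_bound (r : R) z h k : normc z <= r -> normc (z + h) <= r ->
  normc ((z + h) ^+ k - z ^+ k - h * (k%:R * z ^+ k.-1)) <=
  normc h ^+ 2 * ('C(k, 2)%:R * r ^+ (k - 2)).
Proof.
move=> zr zhr; have r0 : 0 <= r by apply: le_trans zr; exact: normc_ge0.
elim: k => [|k IH].
  by rewrite !expr0 subrr mul0r mulr0 subrr normc0 bin0n mul0r mulr0.
have -> : (z + h) ^+ k.+1 - z ^+ k.+1 - h * (k.+1%:R * z ^+ k.+1.-1) =
    z * ((z + h) ^+ k - z ^+ k - h * (k%:R * z ^+ k.-1)) + h * ((z + h) ^+ k - z ^+ k).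
  case: k {IH} => [|k]; first by rewrite !expr0 !expr1; ring.
  by rewrite /= -[k.+2%:R]natr1 !exprS; ring.
apply: le_trans (normc_triangle _ _) _; rewrite !normcM.
have -> : normc h ^+ 2 * ('C(k.+1, 2)%:R * r ^+ (k.+1 - 2)) =
    r * (normc h ^+ 2 * ('C(k, 2)%:R * r ^+ (k - 2))) +
    normc h * (normc h * ('C(k, 1)%:R * r ^+ (k - 1))).
  rewrite binS natrD subSS.
  case: k {IH} => [|[|k]]; first by rewrite !bin0n /=; ring.
    by rewrite (bin_small (ltnSn 1)); ring.
  by rewrite !subSS !subn0 (exprS r); ring.
apply: lerD; first by rewrite ler_pM ?normc_ge0.
by rewrite ler_wpM2l ?normc_ge0// expr_diff_bound.
Qed.

Lemma geometric_sum_le (r : R) n : 0 <= r < 1 ->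
  \sum_(0 <= k < n) r ^+ k <= (1 - r)^-1.
Proof.
move=> r01; apply: le_trans (binomial_sum_le 0 n r01); apply: ler_sum => k _.
by rewrite bin0 mul1r subn0.
Qed.

Lemma unit_disc_modulus z : unit_disc z -> 0 <= normc z < 1.
Proof. by move=> z1; rewrite normc_ge0. Qed.

Lemma bounded_taylor_exists a : (forall k, normc (a k) <= 1) ->
  exists f : R[i] -> R[i], taylor_coefficients f a.
Proof.
move=> a1.
have [f fP] : {f : R[i] -> R[i] & forall z, unit_disc z ->
    ([series (a n * z ^+ n : R[i]^o)]_n : nat -> R[i]^o) @ \oo --> (f z : R[i]^o)}.
  apply: (@choice _ _ (fun z l => unit_disc z ->
    ([series (a n * z ^+ n : R[i]^o)]_n : nat -> R[i]^o) @ \oo --> (l : R[i]^o))) => z.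
  have [z1|z1] := pselect (unit_disc z); last by exists 0.
  have [|l lP] := @complex_series_cvg (fun n => a n * z ^+ n) (1 - normc z)^-1.
    move=> n; apply: le_trans (geometric_sum_le n (unit_disc_modulus z1)).
    apply: ler_sum => k _.
    by rewrite normcM normcX ler_piMl// exprn_ge0// normc_ge0.
  by exists l.
by exists f.
Qed.

Lemma taylor_tail f a n z : (forall k, normc (a k) <= 1) ->
  taylor_coefficients f a -> unit_disc z ->
  normc (f z - poly_eval a n z) <= normc z ^+ n / (1 - normc z).
Proof.
move=> a1 fa z1; have z01 := unit_disc_modulus z1.
apply: (cvg_normc_le (n0 := n) (fa z z1)) => m nm.
rewrite /series /= /poly_eval (big_cat_nat (n := n) (p := m))//= addrAC subrr add0r.
apply: le_trans (normc_sum _ _ _) _.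
apply: (@le_trans _ _ (normc z ^+ n * \sum_(0 <= k < m - n) normc z ^+ k)).
  rewrite -{1}[n]add0n big_addn mulr_sumr; apply: ler_sum => k _.
  by rewrite normcM normcX addnC exprD ler_piMl// mulr_ge0 ?exprn_ge0 ?normc_ge0.
by rewrite ler_wpM2l ?exprn_ge0 ?normc_ge0// geometric_sum_le.
Qed.

(** Summing [expr_taylor_bound] over [k], with the termwise derivative [g], gives
    [|f (z + h) - f z - h g| <= C |h|^2] in a disc of radius [r < 1] that
    contains [z] in its interior; [C] is finite by [binomial_sum_le]. *)
Lemma bounded_taylor_analytic f a : (forall k, normc (a k) <= 1) ->
  taylor_coefficients f a -> analytic_in_disc f.
Proof.
move=> a1 fa z z1; move: (z1); rewrite /unit_disc /= => zlt.
pose r := (1 + normc z) / 2.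
have zr : normc z < r by rewrite /r; lra.
have r01 : 0 <= r < 1 by apply/andP; split; rewrite /r; have := normc_ge0 z; lra.
have [|g gP] := @complex_series_cvg
    (fun n => a n * (n%:R * z ^+ n.-1)) ((1 - r)^-1 ^+ 2).
  move=> n; apply: le_trans (binomial_sum_le 1 n r01); apply: ler_sum => k _.
  rewrite !normcM bin1 subn1 normcX.
  have -> : normc (k%:R : R[i]) = k%:R :> R.
    by have := normc_real (k%:R : R); rewrite rmorph_nat normr_nat.
  apply: le_trans (ler_piMl _ (a1 k)) _.
    by rewrite mulr_ge0 ?exprn_ge0 ?normc_ge0.
  by rewrite ler_wpM2l// lerXn2r ?nnegrE ?normc_ge0 ?(ltW zr)//; move: r01 => /andP[].
pose C := (1 - r)^-1 ^+ 3.
have C0 : 0 < C by rewrite exprn_gt0// invr_gt0 subr_gt0; move: r01 => /andP[].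
have key h : normc (z + h) <= r ->
    normc (f (z + h) - f z - h * g) <= normc h ^+ 2 * C.
  move=> zhr; have zh1 : unit_disc (z + h).
    by rewrite /unit_disc /=; apply: le_lt_trans zhr _; move: r01 => /andP[].
  move: (fa _ zh1) (fa _ z1) gP => fzh fz gP.
  rewrite -[f _ - _ - _]subr0; apply: (cvg_normc_le (n0 := 0)
    (u := fun n => \sum_(0 <= k < n)
      a k * ((z + h) ^+ k - z ^+ k - h * (k%:R * z ^+ k.-1)))).
    rewrite [X in X @ _ --> _](_ : _ = (fun n =>
      series (fun k => a k * (z + h) ^+ k : R[i]^o) n -
      series (fun k => a k * z ^+ k : R[i]^o) n -
      (h : R[i]^o) *: series (fun k => a k * (k%:R * z ^+ k.-1) : R[i]^o) n)).
      apply: cvgB; first exact: cvgB fzh fz.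
      exact: cvgZr gP.
    apply/funext => n; rewrite /series /= scaler_sumr -!sumrB.
    by apply: eq_bigr => k _; rewrite /GRing.scale /=; ring.
  move=> n _; rewrite subr0; apply: le_trans (normc_sum _ _ _) _.
  apply: (@le_trans _ _
    (normc h ^+ 2 * \sum_(0 <= k < n) 'C(k, 2)%:R * r ^+ (k - 2))).
    rewrite mulr_sumr; apply: ler_sum => k _; rewrite normcM.
    apply: le_trans (expr_taylor_bound k (ltW zr) zhr).
    by rewrite ler_piMl ?normc_ge0.
  by rewrite ler_wpM2l ?sqr_ge0// binomial_sum_le.
apply/cvg_ex; exists (g : R[i]^o); apply/cvgrPdist_le => e e0.
have [er e0'] : e = (complex.Re e)%:C%C /\ 0 < complex.Re e.
  case: e e0 => x y; rewrite ltcE /= => /andP[/eqP -> x0].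
  by split.
pose d := Num.min (r - normc z) (complex.Re e / C).
have d0 : 0 < d by rewrite lt_min subr_gt0 zr divr_gt0.
have dC : 0 < d%:C%C :> R[i] by rewrite ltcR.
near=> h.
have h0 : h != 0 by near: h; exact: nbhs_dnbhs_neq.
have hd : normc h <= d.
  rewrite -lecR -normcEabs; near: h; exact: dnbhs0_le.
rewrite er normcEabs lecR /= .
have -> : g - h^-1 *: (f (h *: (1 : R[i]^o) + z) - f z) =
    - (h^-1 * (f (z + h) - f z - h * g)).
  by rewrite /GRing.scale /= mulr1 [h + z]addrC [in RHS]mulrBr mulKf// opprB.
rewrite normc_opp normcM normcV.
have nh0 : 0 < normc h.
  by rewrite lt_def normc_ge0 andbT; apply: contra_neq h0; exact: eq0_normc.
rewrite ler_pdivrMl//.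
have hr : normc (z + h) <= r.
  apply: le_trans (normc_triangle _ _) _; rewrite -lerBrDl.
  by apply: le_trans hd _; rewrite /d ge_min lexx.
apply: le_trans (key h hr) _; rewrite expr2 -mulrA ler_wpM2l ?normc_ge0//.
rewrite -ler_pdivlMr//; apply: le_trans hd _.
by rewrite /d ge_min lexx orbT.
Unshelve. all: by end_near. Qed.

(** * Strongly annular functions from blocks *)

Lemma limf_esup_infty (g : R -> \bar R) (r_ : nat -> R) :
  (forall j, 1 - j.+2%:R^-1 <= r_ j < 1) ->
  (forall j, (j%:R%:E <= g (r_ j))%E) -> limf_esup g 1^'- = +oo%E.
Proof.
move=> rP gP; rewrite /limf_esup; apply/eqP; rewrite -leye_eq.
apply: le_ereal_inf_tmp => _ [A A1 <-].
have [d /= d0 dA] := A1.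
have ub j : (d^-1 <= j%:R) -> (j%:R%:E <= ereal_sup (g @` A))%E.
  move=> dj; apply: le_trans (gP j) _; apply: ereal_sup_ubound; exists (r_ j) => //.
  have /andP[r1 r2] := rP j.
  (* Here [1 - r_ j <= 1 / (j + 2) < d]. *)
  apply: dA => //=; rewrite ger0_norm ?subr_ge0 ?(ltW r2)//.
  rewrite ltrBlDl -ltrBlDr; apply: lt_le_trans r1; rewrite ltrD2l ltrN2.
  rewrite invf_plt ?posrE//; apply: le_lt_trans dj _; by rewrite ltr_nat.
rewrite leye_eq; apply/eqP/eq_infty => t.
pose j := (Num.truncn (Num.max t d^-1)).+1.
have jP : Num.max t d^-1 <= j%:R by apply: ltW; exact: truncnS_gt.
apply: le_trans (ub j _); last by apply: le_trans jP; rewrite le_max lexx orbT.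
by rewrite lee_fin; apply: le_trans jP; rewrite le_max lexx.
Qed.

End AnnularFunctions.

Theorem theorem6 (R : realType) (p q : R) (hp : 2 <= p) (hpq : p < q) :
  exists (f : R[i] -> R[i]) (a : nat -> R[i]),
    [/\ strongly_annular f,
        taylor_coefficients f a &
        (ell q `\` ell_tilde p) a].
Proof.
have q0 : 0 < q by apply: lt_trans hpq; exact: lt_le_trans hp.
have [a [n_ [r_ [aq ap rP]]]] := annular_coefficients hp hpq.
have a1 k : normc (a k) <= 1.
  rewrite leNgt; apply/negP => ak; have := aq k.+1.
  rewrite /power_sum big_nat_recr//= leNgt => /negP; apply.
  apply: ltr_wpDl; first by apply: sumr_ge0 => i _; exact: powR_ge0.
  have q1 : (1 : R) `^ q = 1 by rewrite powR1.
  rewrite -[ltLHS]q1; by apply: gt0_ltr_powR => //; rewrite nnegrE ?normc_ge0.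
have [f fa] := bounded_taylor_exists a1.
exists f, a; split; [split|exact: fa|split].
- exact: bounded_taylor_analytic a1 fa.
(* The remainder of the series costs at most [1] on the circle of radius
   [r_ j.+1], hence the shift of the index. *)
- apply: (@limf_esup_infty _ _ (fun j => r_ j.+1)) => j.
    have [/andP[r1 ->] _ _] := rP j.+1; rewrite andbT; apply: le_trans r1.
    by rewrite lerD2l lerN2 lef_pV2 ?posrE// ler_nat.
  have [/andP[r0 r1] rn rM] := rP j.+1.
  apply: le_ereal_inf_tmp => _ [z /= zr <-]; rewrite lee_fin.
  have z1 : unit_disc z by rewrite /unit_disc /= zr.
  have := taylor_tail (n_ j.+1).*2 a1 fa z1; rewrite zr => tail.
  have tail1 : r_ j.+1 ^+ (n_ j.+1).*2 / (1 - r_ j.+1) <= 1.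
    by rewrite ler_pdivrMr ?subr_gt0// mul1r.
  have := normc_lower (f z - poly_eval a (n_ j.+1).*2 z) (poly_eval a (n_ j.+1).*2 z).
  rewrite subrK; have := rM z zr; rewrite -natr1; lra.
- rewrite /ell /=; apply: (@le_lt_trans _ _ 1%:E); last exact: ltry.
  apply: lime_le; first by apply: is_cvg_nneseries => n _ _; rewrite lee_fin powR_ge0.
  by near=> n; rewrite sumEFin lee_fin; exact: aq.
- rewrite /ell_tilde /= => h.
  set S := limn _ in h.
  have lb j : (j%:R%:E <= S)%E.
    apply: (@le_trans _ _ (pair_sum p a (n_ j))%:E); first by rewrite lee_fin.
    rewrite /pair_sum -sumEFin; apply: nneseries_lim_ge => k _ _.
    by rewrite lee_fin le_min !powR_ge0.
  have S0 : (0 <= S)%E := lb 0.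
  have Sfin : S \is a fin_num by rewrite ge0_fin_numE.
  have := lb (Num.truncn (fine S)).+1.
  by rewrite -(fineK Sfin) lee_fin leNgt truncnS_gt.
Unshelve. all: by end_near. Qed.
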